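(* Let $g:I\to\mathbb{H}^2$ be a unit speed space-like curve. Then $$\tilde\gamma(v)=a\int_0^v g(t)\,dt+a\tanh\xi_2\int_0^v g(t)\times g'(t)\,dt$$ is a time-like Bertrand curve, where $a$ and $\xi_2=\xi_2(u)=\coth\theta\,\ln u$ are constants and $\theta$ is a constant different from $0$. Moreover, all time-like Bertrand curves can be constructed by this method.
   Context: Minkowski 3-space $\mathbb{R}^3_1$ is $\mathbb{R}^3$ with $\langle x,y\rangle=x_1y_1+x_2y_2-x_3y_3$ and $\|x\|=\sqrt{|\langle x,x\rangle|}$. A vector $x$ is space-like if $\langle x,x\rangle>0$ or $x=0$, time-like if $\langle x,x\rangle<0$, light-like if $\langle x,x\rangle=0$ and $x\neq0$. A regular curve defined on an interval $I\subset\mathbb{R}$ is space-like (time-like) if all its velocity vectors are; it is unit speed if its velocity has pseudo-norm $1$. The Lorentzian cross product is $x\times y=(x_2y_3-x_3y_2,\;x_3y_1-x_1y_3,\;x_2y_1-x_1y_2)$, so that $\langle x\times y,z\rangle=\det(x,y,z)$. Hyperbolic space is $\mathbb{H}^2=\{x\in\mathbb{R}^3_1:\langle x,x\rangle=-1\}$. For a time-like curve $\alpha$ with arc-length parameter $s$, the Frenet frame is $T=\alpha'$, $N=\alpha''/\|\alpha''\|$, $B=T\times N$; the curvature is $\kappa=\|T'\|$ and the torsion is $\tau=\langle N',B\rangle$. A time-like curve is a (time-like) Bertrand curve if and only if there are non-zero real constants $A,B$ such that $A\kappa(s)+B\tau(s)=1$ for all $s$.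
   Formalization: As printed this fails: the formal version assumes u>0, u≠1, a≠0 and nowhere-vanishing curvature of γ̃, and takes the converse only for Bertrand curves with Aκ+Bτ=1 for some |B|<|A|, up to reparametrization and translation (e.g. κ=2+sin s, τ=(1−κ)/2 is not obtainable). *)

(* Defs.v *)
From Stdlib Require Import Reals ClassicalEpsilon.
From Coquelicot Require Import Coquelicot.
Local Open Scope R_scope.

Record vec : Type := Vec { x1 : R; x2 : R; x3 : R }.

Definition vzero : vec := Vec 0 0 0.
Definition vadd (x y : vec) : vec := Vec (x1 x + x1 y) (x2 x + x2 y) (x3 x + x3 y).
Definition vscale (r : R) (x : vec) : vec := Vec (r * x1 x) (r * x2 x) (r * x3 x).

Definition inner (x y : vec) : R := x1 x * x1 y + x2 x * x2 y - x3 x * x3 y.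
Definition norm (x : vec) : R := sqrt (Rabs (inner x x)).
Definition cross (x y : vec) : vec :=
  Vec (x2 x * x3 y - x3 x * x2 y)
      (x3 x * x1 y - x1 x * x3 y)
      (x2 x * x1 y - x1 x * x2 y).

Definition space_like (x : vec) : Prop := 0 < inner x x \/ x = vzero.
Definition time_like (x : vec) : Prop := inner x x < 0.
Definition in_hyperbolic_space (x : vec) : Prop := inner x x = -1.

(** Intervals may be open, closed, half-open or unbounded, but not reduced to
    a point. *)
Definition interval (I : R -> Prop) : Prop :=
  (forall x y z, I x -> I y -> x <= z <= y -> I z) /\
  (exists x y, I x /\ I y /\ x < y).

(** Functions on an interval [I] are total functions of which only the values
    on [I] matter.  Derivatives are taken along [I], hence one-sided at an
    endpoint belonging to [I].  [deriv I f t] is a junk value when [f] is not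
    differentiable at [t] along [I]. *)
Definition deriv (I : R -> Prop) (f : R -> R) (t : R) : R :=
  epsilon (inhabits 0)
    (fun l => limit1_in (fun x => (f x - f t) / (x - t)) (D_x I t) l t).

Definition differentiable_on (I : R -> Prop) (f : R -> R) : Prop :=
  forall t, I t -> D_in f (deriv I f) I t.

Definition smooth_on (I : R -> Prop) (f : R -> R) : Prop :=
  forall n : nat, differentiable_on I (Nat.iter n (deriv I) f).

Definition D (I : R -> Prop) (c : R -> vec) (t : R) : vec :=
  Vec (deriv I (fun r => x1 (c r)) t)
      (deriv I (fun r => x2 (c r)) t)
      (deriv I (fun r => x3 (c r)) t).

Definition curve (I : R -> Prop) (c : R -> vec) : Prop :=
  interval I /\
  smooth_on I (fun r => x1 (c r)) /\
  smooth_on I (fun r => x2 (c r)) /\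
  smooth_on I (fun r => x3 (c r)).

Definition regular_curve (I : R -> Prop) (c : R -> vec) : Prop :=
  curve I c /\ forall t, I t -> D I c t <> vzero.

Definition space_like_curve (I : R -> Prop) (c : R -> vec) : Prop :=
  regular_curve I c /\ forall t, I t -> space_like (D I c t).

Definition time_like_curve (I : R -> Prop) (c : R -> vec) : Prop :=
  regular_curve I c /\ forall t, I t -> time_like (D I c t).

Definition unit_speed (I : R -> Prop) (c : R -> vec) : Prop :=
  forall t, I t -> norm (D I c t) = 1.

(** [alpha] on [J] is the curve [c] on [I] expressed in an arc-length
    parameter [s]. *)
Definition arc_length_param
    (I : R -> Prop) (c : R -> vec) (J : R -> Prop) (alpha : R -> vec) : Prop :=
  curve J alpha /\ unit_speed J alpha /\
  exists s : R -> R,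
    smooth_on I s /\
    (forall t, I t -> deriv I s t = norm (D I c t)) /\
    (forall r, J r <-> exists t, I t /\ r = s t) /\
    (forall t, I t -> c t = alpha (s t)).

(** The Frenet apparatus of a curve [alpha] on [J] parametrized by arc length;
    [normal], [binormal] and [torsion] are meaningful only where
    [curvature <> 0]. *)
Definition tangent (J : R -> Prop) (alpha : R -> vec) (s : R) : vec :=
  D J alpha s.
Definition normal (J : R -> Prop) (alpha : R -> vec) (s : R) : vec :=
  vscale (/ norm (D J (D J alpha) s)) (D J (D J alpha) s).
Definition binormal (J : R -> Prop) (alpha : R -> vec) (s : R) : vec :=
  cross (tangent J alpha s) (normal J alpha s).
Definition curvature (J : R -> Prop) (alpha : R -> vec) (s : R) : R :=
  norm (D J (tangent J alpha) s).
Definition torsion (J : R -> Prop) (alpha : R -> vec) (s : R) : R :=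
  inner (D J (normal J alpha) s) (binormal J alpha s).

Definition curvature_nowhere_zero (I : R -> Prop) (c : R -> vec) : Prop :=
  forall J alpha, arc_length_param I c J alpha ->
  forall s, J s -> curvature J alpha s <> 0.

Definition time_like_bertrand_with
    (A B : R) (I : R -> Prop) (c : R -> vec) : Prop :=
  time_like_curve I c /\
  exists (J : R -> Prop) (alpha : R -> vec),
    arc_length_param I c J alpha /\
    (forall s, J s -> curvature J alpha s <> 0) /\
    A <> 0 /\ B <> 0 /\
    (forall s, J s -> A * curvature J alpha s + B * torsion J alpha s = 1).

Definition time_like_bertrand (I : R -> Prop) (c : R -> vec) : Prop :=
  exists A B : R, time_like_bertrand_with A B I c.

Definition coth (x : R) : R := cosh x / sinh x.
Definition xi2 (theta u : R) : R := coth theta * ln u.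

Definition integral0 (c : R -> vec) (v : R) : vec :=
  Vec (RInt (fun t => x1 (c t)) 0 v)
      (RInt (fun t => x2 (c t)) 0 v)
      (RInt (fun t => x3 (c t)) 0 v).

Definition gamma_tilde
    (I : R -> Prop) (g : R -> vec) (a xi : R) (v : R) : vec :=
  vadd (vscale a (integral0 g v))
       (vscale (a * tanh xi) (integral0 (fun t => cross (g t) (D I g t)) v)).

(* Main.v *)
From Coquelicot Require Import Coquelicot.
From Stdlib Require Import Lra ClassicalEpsilon.
Require Import Defs.
From Stdlib Require Import Reals.
Local Open Scope R_scope.

(** Put [w = tanh xi], [h = cross g g'] and write [k] for the geodesic curvature
    of [g] in the hyperbolic plane.

    The vectors [g, g', h] form a moving frame with [g'' = g + k h] and
    [h' = - k g'] ([vder_cross_position_velocity]). The velocity of the curve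
    built from [g] is [a (g + w h)], by the fundamental theorem of calculus
    ([vder_gamma_tilde]). Its square is the negative constant [- a^2 (1 - w^2)],
    so the curve is time-like and arc length is a constant multiple of the
    parameter. Its acceleration [a (1 - w k) g'] is parallel to [g'], which
    therefore is the Frenet normal up to a sign, constant because the curvature
    does not vanish. Consequently curvature and torsion are affine functions of
    [k], and eliminating [k] between them leaves a linear relation with
    constant coefficients ([antiderivative_bertrand]).

    Conversely, let [A kappa + B tau = 1] with [|B| < |A|] along a time-like curve
    of unit speed whose Frenet frame is [T, N, b], and put [w = B / A], which has
    modulus less than [1] and hence is a hyperbolic tangent ([tanh_surj]). The Frenet equations
    show that [T - w b] has derivative [(kappa + w tau) N = N / A]: it moves along
    [N] at constant speed, on a hyperboloid. Normalized, and with its parameter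
    rescaled, it is the unit speed curve [g] ([indicatrix]). Its velocity is [N],
    and since [cross b N = T] the combination [A (g + w h)] is the velocity of the
    given curve ([indicatrix_velocity]). Integration recovers the curve up to a
    translation ([indicatrix_integral]).

    Intervals may contain their endpoints, and values outside them are
    arbitrary, so derivatives, integrals and smoothness are handled along the
    interval. Theorems that assume two-sided regularity are reached by composing
    with the retraction onto a compact segment ([clamp]). Smoothness of the
    functions involved follows from the stability of a class of expressions
    under derivation ([smooth_expr]). *)

(** * Calculus along an interval *)

(** The primitive [D_in] treats one point at a time; here the derivative holds
    at every point of [I], and is one-sided at an endpoint of [I]. *)
Definition der (I : R -> Prop) (f f' : R -> R) : Prop :=
  forall t, I t -> D_in f f' I t.

Definition cont (I : R -> Prop) (f : R -> R) : Prop :=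
  forall t, I t -> limit1_in f I (f t) t.

Lemma interval_between (I : R -> Prop) (a b x : R) :
  interval I -> I a -> I b -> Rmin a b <= x <= Rmax a b -> I x.
Proof.
  intros [HI _] Ha Hb Hx.
  destruct (Rle_dec a b).
  - rewrite Rmin_left, Rmax_right in Hx by lra. exact (HI a b x Ha Hb Hx).
  - rewrite Rmin_right, Rmax_left in Hx by lra. exact (HI b a x Hb Ha Hx).
Qed.

(** Non-degeneracy of an interval is what makes derivatives along it unique:
    every point is approached by other points of the interval. *)
Lemma interval_adherent (I : R -> Prop) (t : R) :
  interval I -> I t -> adhDa (D_x I t) t.
Proof.
  intros [HI [x [y [Hx [Hy Hxy]]]]] Ht e He.
  destruct (Rlt_dec t y) as [Hty | Hty].
  - exists (Rmin y (t + e / 2)).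
    pose proof (Rmin_l y (t + e / 2)). pose proof (Rmin_r y (t + e / 2)).
    assert (t < Rmin y (t + e / 2)) by (apply Rmin_glb_lt; lra).
    split; [split |].
    + apply (HI t y _); auto; lra.
    + lra.
    + unfold Rdist; apply Rabs_def1; lra.
  - exists (Rmax x (t - e / 2)).
    pose proof (Rmax_l x (t - e / 2)). pose proof (Rmax_r x (t - e / 2)).
    assert (Rmax x (t - e / 2) < t) by (apply Rmax_lub_lt; lra).
    split; [split |].
    + apply (HI x t _); auto; lra.
    + lra.
    + unfold Rdist; apply Rabs_def1; lra.
Qed.

Lemma der_ext (I : R -> Prop) (f f' g g' : R -> R) :
  (forall t, I t -> f t = g t) -> (forall t, I t -> f' t = g' t) ->
  der I f f' -> der I g g'.
Proof.
  intros Hf Hf' H t Ht e He.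
  destruct (H t Ht e He) as [d [Hd Hl]].
  exists d; split; [exact Hd |].
  intros x [[Hx Hn] Hxt].
  rewrite <- (Hf x Hx), <- (Hf t Ht), <- (Hf' t Ht).
  apply Hl. split; [split |]; assumption.
Qed.

Lemma der_unique (I : R -> Prop) (f d1 d2 : R -> R) (t : R) :
  interval I -> I t -> der I f d1 -> der I f d2 -> d1 t = d2 t.
Proof.
  intros HI Ht H1 H2.
  exact (single_limit _ _ _ _ _ (interval_adherent I t HI Ht) (H1 t Ht) (H2 t Ht)).
Qed.

(** The choice made by [deriv] only needs one candidate limit to become
    meaningful. *)
Lemma der_deriv (I : R -> Prop) (f f' : R -> R) :
  der I f f' -> der I f (deriv I f).
Proof.
  intros H t Ht. unfold D_in, deriv.
  apply epsilon_spec. exists (f' t). exact (H t Ht).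
Qed.

Lemma deriv_eq (I : R -> Prop) (f f' : R -> R) (t : R) :
  interval I -> I t -> der I f f' -> deriv I f t = f' t.
Proof.
  intros HI Ht H.
  exact (der_unique I f _ _ t HI Ht (der_deriv I f f' H) H).
Qed.

Lemma der_const (I : R -> Prop) (c : R) : der I (fun _ => c) (fun _ => 0).
Proof. intros t _. apply Dconst. Qed.

Lemma der_plus (I : R -> Prop) (f f' g g' : R -> R) :
  der I f f' -> der I g g' ->
  der I (fun t => f t + g t) (fun t => f' t + g' t).
Proof. intros Hf Hg t Ht. apply Dadd; auto. Qed.

Lemma der_mult (I : R -> Prop) (f f' g g' : R -> R) :
  der I f f' -> der I g g' ->
  der I (fun t => f t * g t) (fun t => f' t * g t + f t * g' t).
Proof. intros Hf Hg t Ht. apply Dmult; auto. Qed.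

Lemma der_minus (I : R -> Prop) (f f' g g' : R -> R) :
  der I f f' -> der I g g' ->
  der I (fun t => f t - g t) (fun t => f' t - g' t).
Proof. intros Hf Hg t Ht. apply Dminus; auto. Qed.

Lemma der_affine (I : R -> Prop) (s0 p : R) :
  der I (fun r => s0 + p * r) (fun _ => p).
Proof.
  eapply der_ext; [| | apply der_plus; [apply (der_const I s0) |
    apply der_mult; [apply (der_const I p) | intros t _; apply Dx]]];
    intros t _; simpl; ring.
Qed.

Lemma der_comp (I J : R -> Prop) (s s' f f' : R -> R) :
  (forall t, I t -> J (s t)) -> der I s s' -> der J f f' ->
  der I (fun t => f (s t)) (fun t => s' t * f' (s t)).
Proof.
  intros HIJ Hs Hf t Ht.
  apply (D_in_imp _ _ (Dgf I J s)).
  - intros x Hx; split; auto.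
  - apply Dcomp; auto.
Qed.

(** An outer function that is differentiable on both sides, such as the inverse
    or the square root, is brought under the chain rule by letting its domain
    be the whole line. *)
Lemma der_comp_pt (I : R -> Prop) (f f' h h' : R -> R) :
  der I f f' -> (forall t, I t -> derivable_pt_lim h (f t) (h' (f t))) ->
  der I (fun t => h (f t)) (fun t => f' t * h' (f t)).
Proof.
  intros Hf Hh t Ht.
  apply (D_in_imp _ _ (Dgf I no_cond f)).
  - intros x Hx; split; [exact Hx | exact Logic.I].
  - apply Dcomp; [auto |]. apply derivable_pt_lim_D_in, Hh, Ht.
Qed.

Lemma der_inv (I : R -> Prop) (f f' : R -> R) :
  (forall t, I t -> f t <> 0) -> der I f f' ->
  der I (fun t => / f t) (fun t => f' t * (-1 * (/ f t * / f t))).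
Proof.
  intros Hn Hf.
  apply (der_comp_pt I f f' Rinv (fun y => -1 * (/ y * / y))); [exact Hf |].
  intros t Ht. apply is_derive_Reals.
  auto_derive; [apply Hn, Ht | field; apply Hn, Ht].
Qed.

Lemma der_sqrt (I : R -> Prop) (f f' : R -> R) :
  (forall t, I t -> 0 < f t) -> der I f f' ->
  der I (fun t => sqrt (f t)) (fun t => f' t * / (2 * sqrt (f t))).
Proof.
  intros Hp Hf.
  apply (der_comp_pt I f f' sqrt (fun y => / (2 * sqrt y))); [exact Hf |].
  intros t Ht. apply derivable_pt_lim_sqrt, Hp, Ht.
Qed.

Lemma der_cont (I : R -> Prop) (f f' : R -> R) : der I f f' -> cont I f.
Proof.
  intros H t Ht e He.
  destruct (cont_deriv _ _ _ _ (H t Ht) e He) as [d [Hd Hl]].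
  exists d; split; [exact Hd |].
  intros x [Hx Hxt].
  destruct (Req_dec t x) as [-> | Hn].
  - simpl. rewrite Rdist_eq. exact He.
  - apply Hl. split; [split |]; assumption.
Qed.

(** * Continuity, integration and constancy up to the endpoints *)

(** Composing with the retraction of the line onto [[a, b]] turns a function
    that is well behaved along an interval into one that is continuous
    everywhere, without changing it on [[a, b]]: the two-sided theorems of
    calculus then apply up to the endpoints. *)
Definition clamp (a b x : R) : R := Rmax a (Rmin b x).

Lemma clamp_in (a b x : R) : a <= b -> a <= clamp a b x <= b.
Proof.
  intros Hab. unfold clamp. split; [apply Rmax_l |].
  apply Rmax_lub; [exact Hab | apply Rmin_l].
Qed.

Lemma clamp_id (a b x : R) : a <= x <= b -> clamp a b x = x.
Proof. intros H. unfold clamp. rewrite Rmin_right, Rmax_right; lra. Qed.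

Lemma clamp_contract (a b x y : R) :
  Rabs (clamp a b x - clamp a b y) <= Rabs (x - y).
Proof.
  assert (Hmax : forall u v, Rabs (Rmax a u - Rmax a v) <= Rabs (u - v)).
  { intros u v. unfold Rmax, Rabs.
    destruct (Rle_dec a u), (Rle_dec a v); repeat destruct Rcase_abs; lra. }
  apply (Rle_trans _ _ _ (Hmax _ _)).
  unfold Rmin, Rabs.
  destruct (Rle_dec b x), (Rle_dec b y); repeat destruct Rcase_abs; lra.
Qed.

Lemma cont_clamp (I : R -> Prop) (f : R -> R) (a b : R) :
  interval I -> cont I f -> I a -> I b -> a <= b ->
  continuity (fun x => f (clamp a b x)).
Proof.
  intros HI Hf Ha Hb Hab x e He.
  assert (Hin : forall y, I (clamp a b y)).
  { intros y. apply (proj1 HI a b _ Ha Hb), clamp_in, Hab. }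
  destruct (Hf _ (Hin x) e He) as [d [Hd Hl]].
  exists d; split; [exact Hd |].
  intros y [_ Hy]. apply Hl. split; [apply Hin |].
  eapply Rle_lt_trans; [apply clamp_contract | exact Hy].
Qed.

Lemma ivt_sign (I : R -> Prop) (f : R -> R) (a b : R) :
  interval I -> cont I f -> (forall t, I t -> f t <> 0) ->
  I a -> I b -> 0 < f a -> 0 < f b.
Proof.
  intros HI Hf Hn.
  assert (Hw : forall a b, I a -> I b -> a <= b -> 0 < f a * f b).
  { clear a b. intros a b Ha Hb Hab.
    destruct (Rlt_dec 0 (f a * f b)) as [|Hneg]; [assumption | exfalso].
    (* A product that is not positive puts [0] between the two values. *)
    destruct (IVT_gen (fun x => f (clamp a b x)) a b 0) as [c [Hc Hc0]].
    - apply (cont_clamp I); assumption.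
    - rewrite !clamp_id by lra.
      unfold Rmin, Rmax; destruct (Rle_dec (f a) (f b)); split; nra.
    - apply (Hn (clamp a b c)); [| exact Hc0].
      apply (proj1 HI a b _ Ha Hb), clamp_in, Hab. }
  intros Ha Hb Hp.
  destruct (Rle_dec a b) as [Hab | Hab].
  - specialize (Hw a b Ha Hb Hab). nra.
  - specialize (Hw b a Hb Ha ltac:(lra)). nra.
Qed.

Lemma sign_const (I : R -> Prop) (f : R -> R) :
  interval I -> cont I f -> (forall t, I t -> f t <> 0) ->
  exists eta, eta * eta = 1 /\ forall t, I t -> Rabs (f t) = eta * f t.
Proof.
  intros HI Hf Hn.
  destruct (classic (exists t, I t /\ 0 < f t)) as [[a [Ha Hp]] | Hnone].
  - exists 1; split; [ring |]. intros t Ht.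
    rewrite Rabs_right; [ring |].
    left; exact (ivt_sign I f a t HI Hf Hn Ha Ht Hp).
  - exists (-1); split; [ring |]. intros t Ht.
    rewrite Rabs_left; [ring |].
    specialize (Hn t Ht).
    destruct (Rlt_dec 0 (f t)); [| lra].
    exfalso; apply Hnone; exists t; auto.
Qed.

Lemma cont_ex_RInt (I : R -> Prop) (f : R -> R) (a b : R) :
  interval I -> cont I f -> I a -> I b -> ex_RInt f a b.
Proof.
  intros HI Hf.
  assert (Hw : forall a b, I a -> I b -> a <= b -> ex_RInt f a b).
  { clear a b. intros a b Ha Hb Hab.
    apply (ex_RInt_ext (fun x => f (clamp a b x))).
    - intros x Hx. rewrite Rmin_left, Rmax_right in Hx by lra.
      rewrite clamp_id; [reflexivity | lra].
    - apply (ex_RInt_continuous (fun x => f (clamp a b x))).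
      intros z _. apply continuity_pt_filterlim.
      apply (cont_clamp I); assumption. }
  intros Ha Hb.
  destruct (Rle_dec a b); [auto |].
  apply ex_RInt_swap, Hw; auto; lra.
Qed.

(** Stated without assuming [a <= b], since the fundamental theorem of calculus
    approaches its point from both sides. *)
Lemma RInt_near_const (f : R -> R) (a b c e : R) :
  0 <= e -> ex_RInt f a b ->
  (forall x, Rmin a b <= x <= Rmax a b -> Rabs (f x - c) <= e) ->
  Rabs (RInt f a b - (b - a) * c) <= Rabs (b - a) * e.
Proof.
  intros He.
  assert (Hw : forall a b, a <= b -> ex_RInt f a b ->
    (forall x, a <= x <= b -> Rabs (f x - c) <= e) ->
    Rabs (RInt f a b - (b - a) * c) <= (b - a) * e).
  { clear a b. intros a b Hab Hex Hb.
    assert (Hc : ex_RInt (fun _ : R => c) a b) by apply ex_RInt_const.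
    replace (RInt f a b - (b - a) * c) with (RInt (fun x => f x - c) a b).
    - apply abs_RInt_le_const; [exact Hab | | exact Hb].
      apply (ex_RInt_minus f (fun _ => c)); assumption.
    - transitivity (minus (RInt f a b) (RInt (fun _ => c) a b)).
      + exact (RInt_minus f (fun _ => c) a b Hex Hc).
      + rewrite RInt_const. reflexivity. }
  intros Hex Hb.
  destruct (Rle_dec a b) as [Hab | Hab].
  - rewrite (Rabs_right (b - a)) by lra.
    rewrite Rmin_left, Rmax_right in Hb by lra. auto.
  - rewrite (Rabs_left (b - a)) by lra.
    rewrite Rmin_right, Rmax_left in Hb by lra.
    rewrite <- opp_RInt_swap by (apply ex_RInt_swap; exact Hex).
    replace (opp (RInt f b a) - (b - a) * c)
      with (- (RInt f b a - (a - b) * c)) by (unfold opp; simpl; ring).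
    rewrite Rabs_Ropp.
    replace (- (b - a)) with (a - b) by ring.
    apply Hw; [lra | apply ex_RInt_swap; exact Hex | exact Hb].
Qed.

(** The fundamental theorem of calculus along an interval: near an endpoint of
    [I] only increments that stay in [I] are considered, so the arbitrary values
    of [f] outside [I] are never integrated. *)
Lemma der_RInt (I : R -> Prop) (f : R -> R) (a : R) :
  interval I -> I a -> cont I f -> der I (fun v => RInt f a v) f.
Proof.
  intros HI Ha Hf t Ht e He.
  destruct (Hf t Ht (e / 2) ltac:(lra)) as [d [Hd Hl]].
  exists d; split; [exact Hd |].
  intros x [[Hx Hn] Hxt].
  assert (Hex : ex_RInt f t x) by (apply (cont_ex_RInt I); assumption).
  assert (Hch : RInt f a x - RInt f a t = RInt f t x).
  { assert (Hat : ex_RInt f a t) by (apply (cont_ex_RInt I); assumption).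
    rewrite <- (RInt_Chasles f a t x Hat Hex). unfold plus; simpl; ring. }
  simpl. unfold Rdist. rewrite Hch.
  replace (RInt f t x / (x - t) - f t)
    with ((RInt f t x - (x - t) * f t) / (x - t)) by (field; lra).
  unfold Rdiv. rewrite Rabs_mult, Rabs_inv.
  assert (Hpos : 0 < Rabs (x - t)) by (apply Rabs_pos_lt; lra).
  apply (Rmult_lt_reg_r (Rabs (x - t))); [exact Hpos |].
  rewrite Rmult_assoc, Rinv_l, Rmult_1_r by lra.
  apply Rle_lt_trans with (Rabs (x - t) * (e / 2)); [| nra].
  apply RInt_near_const; [lra | exact Hex |].
  intros y Hy. left. apply Hl. split.
  - exact (interval_between I t x y HI Ht Hx Hy).
  - simpl in *. unfold Rdist in *.
    eapply Rle_lt_trans; [| exact Hxt].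
    unfold Rmin, Rmax in Hy; destruct (Rle_dec t x);
    unfold Rabs; destruct (Rcase_abs (y - t)), (Rcase_abs (x - t)); lra.
Qed.

(** The mean value theorem needs a two-sided derivative only in the open
    segment, where the derivative along [I] is one; continuity of the clamped
    function takes care of the endpoints. *)
Lemma der_zero_const (I : R -> Prop) (f : R -> R) (a b : R) :
  interval I -> der I f (fun _ => 0) -> I a -> I b -> f a = f b.
Proof.
  intros HI Hf.
  assert (Hw : forall a b, I a -> I b -> a <= b -> f a = f b).
  { clear a b. intros a b Ha Hb Hab.
    destruct (MVT_gen (fun x => f (clamp a b x)) a b (fun _ => 0))
      as [c [_ Hc]].
    - rewrite Rmin_left, Rmax_right by lra. intros x Hx.
      apply (is_derive_ext_loc f).
      + apply (locally_interval _ x (Finite a) (Finite b));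
          [simpl; lra | simpl; lra |].
        intros y Hay Hyb. simpl in Hay, Hyb. rewrite clamp_id; [reflexivity | lra].
      + apply is_derive_Reals.
        assert (Hx' : I x) by (apply (proj1 HI a b _ Ha Hb); lra).
        apply derivable_pt_lim_D_in with (df := fun _ => 0).
        intros e He. destruct (Hf x Hx' e He) as [d [Hd Hl]].
        exists (Rmin d (Rmin (x - a) (b - x))). split.
        * repeat apply Rmin_glb_lt; lra.
        * intros y [[_ Hn] Hy]. simpl in Hy. unfold Rdist in Hy.
          pose proof (Rmin_l d (Rmin (x - a) (b - x))).
          pose proof (Rmin_r d (Rmin (x - a) (b - x))).
          pose proof (Rmin_l (x - a) (b - x)).
          pose proof (Rmin_r (x - a) (b - x)).
          apply Hl. split; [split; [| exact Hn] | simpl; unfold Rdist; lra].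
          apply Rabs_def2 in Hy.
          apply (proj1 HI a b _ Ha Hb); lra.
    - intros x _. apply (cont_clamp I); try assumption.
      exact (der_cont I f _ Hf).
    - rewrite !clamp_id in Hc by lra. lra. }
  intros Ha Hb. destruct (Rle_dec a b); [auto |].
  symmetry; apply Hw; auto; lra.
Qed.

(** * Smoothness along an interval *)

(** Expressions built from smooth functions. The derivative of such an
    expression is again such an expression, which gives smoothness of all of
    them at once and avoids computing iterated derivatives of products,
    inverses, square roots and composites. *)
Inductive smooth_expr : (R -> Prop) -> (R -> R) -> Prop :=
| se_smooth I f : smooth_on I f -> smooth_expr I f
| se_const I c : smooth_expr I (fun _ => c)
| se_plus I f g : smooth_expr I f -> smooth_expr I g ->
    smooth_expr I (fun t => f t + g t)
| se_mult I f g : smooth_expr I f -> smooth_expr I g ->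
    smooth_expr I (fun t => f t * g t)
| se_inv I f : (forall t, I t -> f t <> 0) -> smooth_expr I f ->
    smooth_expr I (fun t => / f t)
| se_sqrt I f : (forall t, I t -> 0 < f t) -> smooth_expr I f ->
    smooth_expr I (fun t => sqrt (f t))
| se_comp I J s f : (forall t, I t -> J (s t)) -> smooth_expr I s ->
    smooth_expr J f -> smooth_expr I (fun t => f (s t)).

Lemma smooth_deriv (I : R -> Prop) (f : R -> R) :
  smooth_on I f -> smooth_on I (deriv I f).
Proof.
  intros H n.
  assert (Hn : Nat.iter n (deriv I) (deriv I f) = Nat.iter (S n) (deriv I) f).
  { induction n as [|n IH]; [reflexivity |]. simpl. rewrite IH. reflexivity. }
  rewrite Hn. apply H.
Qed.

Lemma smooth_expr_der (I : R -> Prop) (f : R -> R) :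
  smooth_expr I f -> exists f', smooth_expr I f' /\ der I f f'.
Proof.
  induction 1 as [I f Hf | I c | I f g Hf [f' [Ef Df]] Hg [g' [Eg Dg]]
    | I f g Hf [f' [Ef Df]] Hg [g' [Eg Dg]] | I f Hn Hf [f' [Ef Df]]
    | I f Hp Hf [f' [Ef Df]] | I J s f HIJ Hs [s' [Es Ds]] Hf [f' [Ef Df]]].
  - exists (deriv I f). split; [apply se_smooth, smooth_deriv, Hf | exact (Hf O)].
  - exists (fun _ => 0). split; [apply se_const | apply der_const].
  - eexists; split; [| apply (der_plus I f f' g g'); assumption].
    apply se_plus; assumption.
  - eexists; split; [| apply (der_mult I f f' g g'); assumption].
    apply se_plus; apply se_mult; assumption.
  - eexists; split; [| apply (der_inv I f f'); assumption].
    apply se_mult; [assumption |]. apply se_mult; [apply se_const |].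
    apply se_mult; apply se_inv; assumption.
  - eexists; split; [| apply (der_sqrt I f f'); assumption].
    apply se_mult; [assumption |]. apply se_inv.
    + intros t Ht. pose proof (sqrt_lt_R0 _ (Hp t Ht)). lra.
    + apply se_mult; [apply se_const | apply se_sqrt; assumption].
  - eexists; split; [| apply (der_comp I J s s' f f'); assumption].
    apply se_mult; [assumption |]. apply (se_comp I J); assumption.
Qed.

(** Each iterated derivative agrees on [I] with some expression; only agreement
    on [I] can be asked for, because [deriv] is arbitrary outside [I]. *)
Lemma smooth_expr_smooth (I : R -> Prop) (f g : R -> R) :
  interval I -> smooth_expr I f -> (forall t, I t -> f t = g t) ->
  smooth_on I g.
Proof.
  intros HI Hf Hfg n.
  assert (H : exists h, smooth_expr I h /\
              forall t, I t -> h t = Nat.iter n (deriv I) g t).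
  { induction n as [|n [h [Eh Hh]]]; [exists f; auto |].
    destruct (smooth_expr_der I h Eh) as [h' [Eh' Dh]].
    exists h'. split; [exact Eh' |]. intros t Ht. simpl.
    symmetry. apply deriv_eq; [exact HI | exact Ht |].
    apply (der_ext I h h'); auto. }
  destruct H as [h [Eh Hh]].
  destruct (smooth_expr_der I h Eh) as [h' [_ Dh]].
  apply (der_deriv I _ h'). apply (der_ext I h h'); auto.
Qed.

Lemma smooth_of_der (I : R -> Prop) (f f' : R -> R) :
  interval I -> der I f f' -> smooth_on I f' -> smooth_on I f.
Proof.
  intros HI Hf Hs [|n]; [exact (der_deriv I f f' Hf) |].
  assert (Hd : smooth_on I (deriv I f)).
  { apply (smooth_expr_smooth I f'); [exact HI | apply se_smooth, Hs |].
    intros t Ht. symmetry. apply deriv_eq; assumption. }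
  assert (Hn : Nat.iter n (deriv I) (deriv I f) = Nat.iter (S n) (deriv I) f).
  { clear. induction n as [|n IH]; [reflexivity |]. simpl. rewrite IH. reflexivity. }
  rewrite <- Hn. apply Hd.
Qed.

Lemma se_minus (I : R -> Prop) (f g : R -> R) :
  smooth_expr I f -> smooth_expr I g -> smooth_expr I (fun t => f t + -1 * g t).
Proof.
  intros Hf Hg. apply se_plus; [exact Hf |].
  apply se_mult; [apply se_const | exact Hg].
Qed.

Lemma se_id (I : R -> Prop) : interval I -> smooth_expr I (fun r => r).
Proof.
  intros HI. apply se_smooth.
  apply (smooth_of_der I _ (fun _ => 1)); [exact HI | intros t _; apply Dx |].
  apply (smooth_expr_smooth I (fun _ => 1)); [exact HI | apply se_const | reflexivity].
Qed.

Lemma se_affine (I : R -> Prop) (s0 p : R) :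
  interval I -> smooth_expr I (fun r => s0 + p * r).
Proof.
  intros HI. apply se_plus; [apply se_const |].
  apply se_mult; [apply se_const | apply se_id, HI].
Qed.

(** * Lorentzian algebra *)

Ltac vec_ring :=
  repeat match goal with v : vec |- _ => destruct v end;
  unfold vscale, vadd, cross, inner, vzero in *; simpl in *;
  try (f_equal; ring); try ring.

Lemma vec_ext (x y : vec) : x1 x = x1 y -> x2 x = x2 y -> x3 x = x3 y -> x = y.
Proof. destruct x, y; simpl; intros -> -> ->; reflexivity. Qed.

Lemma inner_sym (x y : vec) : inner x y = inner y x.
Proof. vec_ring. Qed.

Lemma inner_vscale_l (r : R) (x y : vec) : inner (vscale r x) y = r * inner x y.
Proof. vec_ring. Qed.

Lemma inner_vscale_r (r : R) (x y : vec) : inner x (vscale r y) = r * inner x y.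
Proof. vec_ring. Qed.

Lemma inner_vadd_l (x y z : vec) : inner (vadd x y) z = inner x z + inner y z.
Proof. vec_ring. Qed.

Lemma inner_vadd_r (x y z : vec) : inner x (vadd y z) = inner x y + inner x z.
Proof. vec_ring. Qed.

Lemma cross_vscale_l (r : R) (x y : vec) : cross (vscale r x) y = vscale r (cross x y).
Proof. vec_ring. Qed.

Lemma cross_vscale_r (r : R) (x y : vec) : cross x (vscale r y) = vscale r (cross x y).
Proof. vec_ring. Qed.

Lemma cross_vadd_l (x y z : vec) : cross (vadd x y) z = vadd (cross x z) (cross y z).
Proof. vec_ring. Qed.

Lemma cross_self (x : vec) : cross x x = vzero.
Proof. vec_ring. Qed.

Lemma vadd_0_l (x : vec) : vadd vzero x = x.
Proof. vec_ring. Qed.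

Lemma vscale_vscale (r s : R) (x : vec) : vscale r (vscale s x) = vscale (r * s) x.
Proof. vec_ring. Qed.

Lemma vscale_1 (x : vec) : vscale 1 x = x.
Proof. vec_ring. Qed.

Lemma inner_cross_l (x y : vec) : inner x (cross x y) = 0.
Proof. vec_ring. Qed.

(** The triple product formula; the signs are opposite to the Euclidean ones. *)
Lemma cross_cross_r (x y z : vec) :
  cross (cross x y) z = vadd (vscale (inner y z) x) (vscale (- inner x z) y).
Proof. vec_ring. Qed.

(** Lagrange's identity; the Lorentzian signature reverses its sign, so that a
    unit time-like and a unit space-like vector have a unit space-like product. *)
Lemma inner_cross_cross (x y : vec) :
  inner (cross x y) (cross x y) =
  - (inner x x * inner y y - inner x y * inner x y).
Proof. vec_ring. Qed.

(** The expansion of a vector in the basis [e, f, cross e f], written without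
    denominators: the factor on the left is the Gram determinant of [e, f]. *)
Lemma frame_expansion (e f y : vec) :
  vscale (inner e e * inner f f - inner e f * inner e f) y =
  vadd (vscale (inner y e * inner f f - inner y f * inner e f) e)
    (vadd (vscale (inner y f * inner e e - inner y e * inner e f) f)
          (vscale (- inner y (cross e f)) (cross e f))).
Proof. vec_ring. Qed.

(** Multiplying by the time-like vector [e] kills the component along [e] and
    turns the orthogonal plane by a quarter. This one fact gives both the derivative of the product of position
    and velocity for a curve in the hyperbolic plane and the Frenet equation of
    the binormal of a time-like curve. *)
Lemma cross_in_normal_plane (e f y : vec) :
  inner e e = -1 -> inner f f = 1 -> inner e f = 0 -> inner y f = 0 ->
  cross e y = vscale (- inner y (cross e f)) f.
Proof.
  intros He Hf Hef Hyf.
  assert (Hy : y = vadd (vscale (- inner y e) e)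
                        (vscale (inner y (cross e f)) (cross e f))).
  { pose proof (frame_expansion e f y) as Hx.
    rewrite He, Hf, Hef, Hyf in Hx.
    apply (f_equal (vscale (-1))) in Hx.
    rewrite vscale_vscale in Hx.
    replace (-1 * (-1 * 1 - 0 * 0)) with 1 in Hx by ring.
    rewrite vscale_1 in Hx. rewrite Hx at 1.
    set (u := inner y e); set (w := inner y (cross e f)); clearbody u w.
    clear. vec_ring. }
  set (k := inner y (cross e f)) in *. rewrite Hy.
  assert (Hc : cross e (cross e f) =
               vadd (vscale (inner e e) f) (vscale (- inner e f) e)) by vec_ring.
  replace (cross e _) with (vscale k (cross e (cross e f)))
    by (generalize (inner y e); clearbody k; clear; intros; vec_ring).
  rewrite Hc, He, Hef. clearbody k; clear; vec_ring.
Qed.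

(** The orthogonal complement of a time-like vector is positive, by the
    Cauchy-Schwarz inequality for the first two coordinates. *)
Lemma inner_pos_of_orth_time_like (t x : vec) :
  time_like t -> inner t x = 0 -> 0 <= inner x x.
Proof.
  unfold time_like, inner. destruct t as [a b c], x as [u v w]; simpl. intros Ht Hx.
  assert (H1 : c * w = a * u + b * v) by lra.
  assert (H2 : (c * c) * (w * w) <= (a * a + b * b) * (u * u + v * v)).
  { replace ((c * c) * (w * w)) with ((c * w) * (c * w)) by ring.
    rewrite H1. pose proof (Rle_0_sqr (a * v - b * u)). unfold Rsqr in *. lra. }
  destruct (Rle_dec 0 (u * u + v * v - w * w)) as [|Hn]; [assumption | exfalso].
  pose proof (Rle_0_sqr a); pose proof (Rle_0_sqr b);
  pose proof (Rle_0_sqr u); pose proof (Rle_0_sqr v); unfold Rsqr in *.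
  nra.
Qed.

Lemma norm_vscale_unit (m : R) (e : vec) :
  inner e e = 1 -> norm (vscale m e) = Rabs m.
Proof.
  intros He. unfold norm. rewrite inner_vscale_l, inner_vscale_r, He.
  replace (m * (m * 1)) with (Rsqr m) by (unfold Rsqr; ring).
  rewrite (Rabs_right (Rsqr m)) by (apply Rle_ge, Rle_0_sqr).
  apply sqrt_Rsqr_abs.
Qed.

Lemma norm_sq (x : vec) : norm x * norm x = Rabs (inner x x).
Proof. apply sqrt_sqrt, Rabs_pos. Qed.

Lemma norm_vzero : norm vzero = 0.
Proof.
  unfold norm. replace (inner vzero vzero) with 0 by vec_ring.
  rewrite Rabs_R0. apply sqrt_0.
Qed.

Lemma space_like_unit (x : vec) : space_like x -> norm x = 1 -> inner x x = 1.
Proof.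
  intros [Hp | ->] H; [| rewrite norm_vzero in H; lra].
  pose proof (norm_sq x) as Hn. rewrite H, Rabs_right in Hn by lra. lra.
Qed.

Lemma time_like_unit (x : vec) : time_like x -> norm x = 1 -> inner x x = -1.
Proof.
  unfold time_like. intros Hp H.
  pose proof (norm_sq x) as Hn. rewrite H, Rabs_left in Hn by lra. lra.
Qed.

(** * Vector-valued functions *)

Definition vder (I : R -> Prop) (c c' : R -> vec) : Prop :=
  der I (fun t => x1 (c t)) (fun t => x1 (c' t)) /\
  der I (fun t => x2 (c t)) (fun t => x2 (c' t)) /\
  der I (fun t => x3 (c t)) (fun t => x3 (c' t)).

Definition vsmooth (I : R -> Prop) (c : R -> vec) : Prop :=
  smooth_on I (fun t => x1 (c t)) /\
  smooth_on I (fun t => x2 (c t)) /\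
  smooth_on I (fun t => x3 (c t)).

Lemma vder_ext (I : R -> Prop) (c c' d d' : R -> vec) :
  (forall t, I t -> c t = d t) -> (forall t, I t -> c' t = d' t) ->
  vder I c c' -> vder I d d'.
Proof.
  intros H H' [H1 [H2 H3]].
  let ext K := (refine (der_ext I _ _ _ _ _ _ K); intros t Ht;
                simpl; rewrite ?(H t Ht), ?(H' t Ht); reflexivity)
  in repeat split; [ext H1 | ext H2 | ext H3].
Qed.

Lemma D_eq (I : R -> Prop) (c c' : R -> vec) (t : R) :
  interval I -> vder I c c' -> I t -> D I c t = c' t.
Proof.
  intros HI [H1 [H2 H3]] Ht.
  apply vec_ext; simpl;
    [apply (deriv_eq I _ (fun t => x1 (c' t)))
    |apply (deriv_eq I _ (fun t => x2 (c' t)))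
    |apply (deriv_eq I _ (fun t => x3 (c' t)))]; assumption.
Qed.

Lemma vsmooth_vder (I : R -> Prop) (c : R -> vec) :
  vsmooth I c -> vder I c (D I c).
Proof. intros [H1 [H2 H3]]. repeat split; [apply (H1 O) | apply (H2 O) | apply (H3 O)]. Qed.

Lemma vsmooth_D (I : R -> Prop) (c : R -> vec) :
  vsmooth I c -> vsmooth I (D I c).
Proof.
  intros [H1 [H2 H3]].
  repeat split; [exact (smooth_deriv _ _ H1) | exact (smooth_deriv _ _ H2)
                |exact (smooth_deriv _ _ H3)].
Qed.

Lemma vsmooth_ext (I : R -> Prop) (c d : R -> vec) :
  interval I -> (forall t, I t -> c t = d t) -> vsmooth I c -> vsmooth I d.
Proof.
  intros HI H [H1 [H2 H3]].
  let ext K := (refine (smooth_expr_smooth I _ _ HI (se_smooth I _ K) _);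
                intros t Ht; simpl; rewrite (H t Ht); reflexivity)
  in repeat split; [ext H1 | ext H2 | ext H3].
Qed.

Lemma vsmooth_of_vder (I : R -> Prop) (c c' : R -> vec) :
  interval I -> vder I c c' -> vsmooth I c' -> vsmooth I c.
Proof.
  intros HI [H1 [H2 H3]] [S1 [S2 S3]].
  repeat split; [exact (smooth_of_der I _ _ HI H1 S1) | exact (smooth_of_der I _ _ HI H2 S2)
                |exact (smooth_of_der I _ _ HI H3 S3)].
Qed.

Lemma vder_vadd (I : R -> Prop) (c c' d d' : R -> vec) :
  vder I c c' -> vder I d d' ->
  vder I (fun t => vadd (c t) (d t)) (fun t => vadd (c' t) (d' t)).
Proof.
  intros [H1 [H2 H3]] [K1 [K2 K3]]. repeat split; apply der_plus; assumption.
Qed.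

Lemma vder_vscale (I : R -> Prop) (r : R) (c c' : R -> vec) :
  vder I c c' -> vder I (fun t => vscale r (c t)) (fun t => vscale r (c' t)).
Proof.
  intros [H1 [H2 H3]].
  let scale K := (refine (der_ext I _ _ _ _ _ _ (der_mult I _ _ _ _ (der_const I r) K));
                  intros t _; simpl; ring)
  in repeat split; [scale H1 | scale H2 | scale H3].
Qed.

Lemma der_inner (I : R -> Prop) (c c' d d' : R -> vec) :
  vder I c c' -> vder I d d' ->
  der I (fun t => inner (c t) (d t))
        (fun t => inner (c' t) (d t) + inner (c t) (d' t)).
Proof.
  intros [H1 [H2 H3]] [K1 [K2 K3]].
  eapply der_ext; [| | apply (der_minus I _ _ _ _
    (der_plus I _ _ _ _ (der_mult I _ _ _ _ H1 K1) (der_mult I _ _ _ _ H2 K2))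
    (der_mult I _ _ _ _ H3 K3))]; intros t _; unfold inner; simpl; ring.
Qed.

Lemma vder_cross (I : R -> Prop) (c c' d d' : R -> vec) :
  vder I c c' -> vder I d d' ->
  vder I (fun t => cross (c t) (d t))
         (fun t => vadd (cross (c' t) (d t)) (cross (c t) (d' t))).
Proof.
  intros [H1 [H2 H3]] [K1 [K2 K3]].
  let minor F G F' G' := (refine (der_ext I _ _ _ _ _ _ (der_minus I _ _ _ _
    (der_mult I _ _ _ _ F G) (der_mult I _ _ _ _ F' G'))); intros t _; simpl; ring)
  in repeat split; [minor H2 K3 H3 K2 | minor H3 K1 H1 K3 | minor H2 K1 H1 K2].
Qed.

Lemma eq_of_vder_eq (I : R -> Prop) (c d d' : R -> vec) (a b : R) :
  interval I -> vder I c d' -> vder I d d' -> I a -> I b ->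
  d a = vzero -> c b = vadd (c a) (d b).
Proof.
  intros HI [H1 [H2 H3]] [K1 [K2 K3]] Ha Hb Hd.
  assert (Hw : forall f h k, der I f k -> der I h k -> f a - h a = f b - h b).
  { intros f h k Hf Hh.
    refine (der_zero_const I (fun t => f t - h t) a b HI _ Ha Hb).
    refine (der_ext I _ _ _ _ _ _ (der_minus I _ _ _ _ Hf Hh));
      intros t _; [reflexivity | ring]. }
  pose proof (Hw _ _ _ H1 K1) as E1. pose proof (Hw _ _ _ H2 K2) as E2.
  pose proof (Hw _ _ _ H3 K3) as E3.
  simpl in E1, E2, E3. rewrite Hd in E1, E2, E3.
  apply vec_ext; simpl in *; lra.
Qed.

(** Differentiating a constant inner product, the source of all orthogonality
    relations below. *)
Lemma inner_const_der (I : R -> Prop) (c c' d d' : R -> vec) (k t : R) :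
  interval I -> vder I c c' -> vder I d d' ->
  (forall r, I r -> inner (c r) (d r) = k) -> I t ->
  inner (c' t) (d t) + inner (c t) (d' t) = 0.
Proof.
  intros HI Hc Hd Hk Ht.
  apply (der_unique I (fun _ => k)
    (fun t => inner (c' t) (d t) + inner (c t) (d' t)) (fun _ => 0) t HI Ht).
  - eapply der_ext; [exact Hk | | apply der_inner; eassumption].
    reflexivity.
  - apply der_const.
Qed.

Lemma inner_self_const_der (I : R -> Prop) (c c' : R -> vec) (k t : R) :
  interval I -> vder I c c' ->
  (forall r, I r -> inner (c r) (c r) = k) -> I t -> inner (c t) (c' t) = 0.
Proof.
  intros HI Hc Hk Ht.
  pose proof (inner_const_der I c c' c c' k t HI Hc Hc Hk Ht) as H.
  rewrite (inner_sym (c' t)) in H. lra.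
Qed.

Lemma smooth_inner (I : R -> Prop) (c d : R -> vec) :
  interval I -> vsmooth I c -> vsmooth I d ->
  smooth_on I (fun t => inner (c t) (d t)).
Proof.
  intros HI [H1 [H2 H3]] [K1 [K2 K3]].
  refine (smooth_expr_smooth I _ _ HI (se_minus I _ _
    (se_plus I _ _ (se_mult I _ _ (se_smooth I _ H1) (se_smooth I _ K1))
                   (se_mult I _ _ (se_smooth I _ H2) (se_smooth I _ K2)))
    (se_mult I _ _ (se_smooth I _ H3) (se_smooth I _ K3))) _).
  intros t _. unfold inner. ring.
Qed.

Lemma vsmooth_vscale (I : R -> Prop) (f : R -> R) (c : R -> vec) :
  interval I -> smooth_expr I f -> vsmooth I c ->
  vsmooth I (fun t => vscale (f t) (c t)).
Proof.
  intros HI Hf [H1 [H2 H3]].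
  let scale K := exact (smooth_expr_smooth I _ _ HI
    (se_mult I _ _ Hf (se_smooth I _ K)) (fun t _ => eq_refl))
  in repeat split; [scale H1 | scale H2 | scale H3].
Qed.

Lemma vsmooth_vadd (I : R -> Prop) (c d : R -> vec) :
  interval I -> vsmooth I c -> vsmooth I d ->
  vsmooth I (fun t => vadd (c t) (d t)).
Proof.
  intros HI [H1 [H2 H3]] [K1 [K2 K3]].
  let add K L := exact (smooth_expr_smooth I _ _ HI
    (se_plus I _ _ (se_smooth I _ K) (se_smooth I _ L)) (fun t _ => eq_refl))
  in repeat split; [add H1 K1 | add H2 K2 | add H3 K3].
Qed.

Lemma vsmooth_cross (I : R -> Prop) (c d : R -> vec) :
  interval I -> vsmooth I c -> vsmooth I d ->
  vsmooth I (fun t => cross (c t) (d t)).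
Proof.
  intros HI [H1 [H2 H3]] [K1 [K2 K3]].
  let minor F G F' G' := (refine (smooth_expr_smooth I _ _ HI
    (se_minus I _ _ (se_mult I _ _ (se_smooth I _ F) (se_smooth I _ G))
                    (se_mult I _ _ (se_smooth I _ F') (se_smooth I _ G'))) _);
    intros t _; simpl; ring)
  in repeat split; [minor H2 K3 H3 K2 | minor H3 K1 H1 K3 | minor H2 K1 H1 K2].
Qed.

Lemma vder_comp (I J : R -> Prop) (s s' : R -> R) (c c' : R -> vec) :
  (forall t, I t -> J (s t)) -> der I s s' -> vder J c c' ->
  vder I (fun t => c (s t)) (fun t => vscale (s' t) (c' (s t))).
Proof.
  intros HIJ Hs [H1 [H2 H3]].
  repeat split; [exact (der_comp I J _ _ _ _ HIJ Hs H1)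
    |exact (der_comp I J _ _ _ _ HIJ Hs H2)|exact (der_comp I J _ _ _ _ HIJ Hs H3)].
Qed.

(** The domain on which [fun r => c (s0 + p * r)] lives when [c] lives on [J].
    Both reparametrizations of the theorem, to arc length and back, have this
    affine form. *)
Definition rescale (J : R -> Prop) (s0 p : R) : R -> Prop :=
  fun r => J (s0 + p * r).

Lemma interval_rescale (J : R -> Prop) (s0 p : R) :
  0 < p -> interval J -> interval (rescale J s0 p).
Proof.
  intros Hp [HJ [x [y [Hx [Hy Hxy]]]]]. split.
  - intros u w z Hu Hw Hz. apply (HJ _ _ _ Hu Hw). nra.
  - exists ((x - s0) / p), ((y - s0) / p). unfold rescale. repeat split.
    + replace (s0 + p * ((x - s0) / p)) with x by (field; lra). exact Hx.
    + replace (s0 + p * ((y - s0) / p)) with y by (field; lra). exact Hy.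
    + apply Rmult_lt_compat_r; [apply Rinv_0_lt_compat, Hp | lra].
Qed.

Lemma vder_rescale (J : R -> Prop) (s0 p : R) (c c' : R -> vec) :
  vder J c c' ->
  vder (rescale J s0 p) (fun r => c (s0 + p * r))
       (fun r => vscale p (c' (s0 + p * r))).
Proof.
  intros [H1 [H2 H3]].
  repeat split;
    [exact (der_comp _ J _ _ _ _ (fun t Ht => Ht) (der_affine _ s0 p) H1)
    |exact (der_comp _ J _ _ _ _ (fun t Ht => Ht) (der_affine _ s0 p) H2)
    |exact (der_comp _ J _ _ _ _ (fun t Ht => Ht) (der_affine _ s0 p) H3)].
Qed.

Lemma se_rescale (J : R -> Prop) (s0 p : R) (f : R -> R) :
  0 < p -> interval J -> smooth_expr J f ->
  smooth_expr (rescale J s0 p) (fun r => f (s0 + p * r)).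
Proof.
  intros Hp HJ Hf.
  apply (se_comp _ J (fun r => s0 + p * r) f); [intros t Ht; exact Ht | | exact Hf].
  apply se_affine, interval_rescale; assumption.
Qed.

Lemma vsmooth_rescale (J : R -> Prop) (s0 p : R) (c : R -> vec) :
  0 < p -> interval J -> vsmooth J c ->
  vsmooth (rescale J s0 p) (fun r => c (s0 + p * r)).
Proof.
  intros Hp HJ [H1 [H2 H3]].
  pose proof (interval_rescale J s0 p Hp HJ) as HI.
  let resc K := exact (smooth_expr_smooth _ _ _ HI
    (se_rescale J s0 p _ Hp HJ (se_smooth J _ K)) (fun t _ => eq_refl))
  in repeat split; [resc H1 | resc H2 | resc H3].
Qed.

Lemma vder_integral0 (I : R -> Prop) (c c' : R -> vec) :
  interval I -> I 0 -> vder I c c' -> vder I (integral0 c) c.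
Proof.
  intros HI H0 [H1 [H2 H3]].
  repeat split; apply der_RInt; try assumption; eapply der_cont; eassumption.
Qed.

(** * Hyperbolic functions and the parameter xi2 *)

Lemma cosh_pos (x : R) : 0 < cosh x.
Proof. unfold cosh. pose proof (exp_pos x). pose proof (exp_pos (- x)). lra. Qed.

Lemma cosh_sq (x : R) : cosh x * cosh x = 1 + sinh x * sinh x.
Proof.
  unfold cosh, sinh.
  assert (exp x * exp (- x) = 1) by (rewrite <- exp_plus, Rplus_opp_r; apply exp_0).
  nra.
Qed.

Lemma sinh_neq_0 (x : R) : x <> 0 -> sinh x <> 0.
Proof.
  intros Hx H. apply Hx. rewrite <- (arcsinh_sinh x), H.
  rewrite <- sinh_0 at 1. apply arcsinh_sinh.
Qed.

Lemma tanh_neq_0 (x : R) : x <> 0 -> tanh x <> 0.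
Proof.
  intros Hx H. apply (sinh_neq_0 x Hx). pose proof (cosh_pos x).
  unfold tanh in H. replace (sinh x) with (sinh x / cosh x * cosh x) by (field; lra).
  rewrite H. ring.
Qed.

Lemma tanh_sq_lt_1 (x : R) : 0 < 1 - tanh x * tanh x.
Proof.
  pose proof (cosh_pos x). pose proof (cosh_sq x).
  replace (1 - tanh x * tanh x) with (/ (cosh x * cosh x)).
  - apply Rinv_0_lt_compat. nra.
  - unfold tanh. field_simplify; [| lra | lra].
    replace (cosh x ^ 2 - sinh x ^ 2) with 1 by lra. reflexivity.
Qed.

(** The witness comes from [sinh x = w * cosh x] and
    [cosh x ^ 2 * (1 - w ^ 2) = 1]. *)
Lemma tanh_surj (w : R) : 0 < 1 - w * w -> exists x, tanh x = w.
Proof.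
  intros Hw. set (k := sqrt (1 - w * w)).
  assert (Hk : 0 < k) by (apply sqrt_lt_R0, Hw).
  assert (Hk2 : k * k = 1 - w * w) by (apply sqrt_sqrt; lra).
  exists (arcsinh (w / k)). unfold tanh. rewrite sinh_arcsinh.
  pose proof (cosh_pos (arcsinh (w / k))) as Hp.
  pose proof (cosh_sq (arcsinh (w / k))) as Hc. rewrite sinh_arcsinh in Hc.
  replace (cosh (arcsinh (w / k))) with (/ k); [field; lra |].
  apply Rsqr_inj; [left; apply Rinv_0_lt_compat, Hk | lra |].
  unfold Rsqr. rewrite Hc.
  replace 1 with ((k * k + w * w) / (k * k) - (w / k) * (w / k)) at 1 by (field; lra).
  rewrite Hk2 at 1. field; lra.
Qed.

Lemma xi2_neq_0 (theta u : R) :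
  theta <> 0 -> 0 < u -> u <> 1 -> xi2 theta u <> 0.
Proof.
  intros Ht Hu Hu1. unfold xi2, coth.
  pose proof (sinh_neq_0 theta Ht). pose proof (cosh_pos theta).
  apply Rmult_integral_contrapositive_currified; [| apply ln_neq_0; assumption].
  unfold Rdiv. apply Rmult_integral_contrapositive_currified; [lra |].
  apply Rinv_neq_0_compat; assumption.
Qed.

(** As [u] varies, already [theta = 1] reaches every number. *)
Lemma xi2_surj (x : R) :
  x <> 0 -> exists theta u, theta <> 0 /\ 0 < u /\ u <> 1 /\ xi2 theta u = x.
Proof.
  intros Hx. pose proof (sinh_neq_0 1 ltac:(lra)) as Hs. pose proof (cosh_pos 1) as Hc.
  exists 1, (exp (x * sinh 1 / cosh 1)).
  split; [lra |]. split; [apply exp_pos |]. split.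
  - intros H. apply (f_equal ln) in H. rewrite ln_exp, ln_1 in H.
    apply Hx. replace x with (x * sinh 1 / cosh 1 * (cosh 1 / sinh 1)) by (field; lra).
    rewrite H. ring.
  - unfold xi2, coth. rewrite ln_exp. field. lra.
Qed.

(** * Unit speed curves in the hyperbolic plane give Bertrand curves *)

Lemma vder_gamma_tilde (I : R -> Prop) (g : R -> vec) (a xi : R) :
  interval I -> I 0 -> vsmooth I g ->
  vder I (gamma_tilde I g a xi)
    (fun t => vscale a (vadd (g t) (vscale (tanh xi) (cross (g t) (D I g t))))).
Proof.
  intros HI H0 Hg.
  pose proof (vsmooth_vder I g Hg) as Dg.
  pose proof (vsmooth_vder I _ (vsmooth_cross I g (D I g) HI Hg (vsmooth_D I g Hg))) as Dh.
  refine (vder_ext I _ _ _ _ _ _ (vder_vadd I _ _ _ _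
    (vder_vscale I a _ _ (vder_integral0 I g _ HI H0 Dg))
    (vder_vscale I (a * tanh xi) _ _ (vder_integral0 I _ _ HI H0 Dh)))).
  - reflexivity.
  - intros t _. generalize (g t), (cross (g t) (D I g t)), (tanh xi). intros. simpl. vec_ring.
Qed.

Lemma gamma_tilde_0 (I : R -> Prop) (g : R -> vec) (a xi : R) :
  gamma_tilde I g a xi 0 = vzero.
Proof.
  unfold gamma_tilde, integral0. rewrite !RInt_point. vec_ring.
  change (@zero R_CompleteNormedModule) with 0. f_equal; ring.
Qed.

Section HyperbolicCurve.
  Variables (I : R -> Prop) (g : R -> vec).
  Hypothesis HI : interval I.
  Hypothesis Hg : vsmooth I g.
  Hypothesis Hh : forall t, I t -> inner (g t) (g t) = -1.
  Hypothesis Hu : forall t, I t -> inner (D I g t) (D I g t) = 1.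

  (** The geodesic curvature of [g] in the hyperbolic plane. *)
  Definition geod_curv (t : R) : R := inner (D I (D I g) t) (cross (g t) (D I g t)).

  Lemma velocity_orth_position (t : R) : I t -> inner (g t) (D I g t) = 0.
  Proof. apply (inner_self_const_der I g _ (-1)); auto using vsmooth_vder. Qed.

  Lemma inner_acceleration_position (t : R) : I t -> inner (D I (D I g) t) (g t) = -1.
  Proof.
    intros Ht.
    pose proof (inner_const_der I g (D I g) (D I g) (D I (D I g)) 0 t HI
      (vsmooth_vder _ _ Hg) (vsmooth_vder _ _ (vsmooth_D _ _ Hg)) velocity_orth_position Ht) as H.
    rewrite (Hu t Ht), (inner_sym (g t)) in H. lra.
  Qed.

  Lemma inner_acceleration_velocity (t : R) : I t -> inner (D I (D I g) t) (D I g t) = 0.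
  Proof.
    intros Ht. rewrite inner_sym.
    apply (inner_self_const_der I _ _ 1);
      auto using vsmooth_vder, vsmooth_D.
  Qed.

  (** The acceleration has no component along the velocity, so the product of
      [g] with it only sees its component along the normal to [g] in the
      hyperbolic plane. *)
  Lemma vder_cross_position_velocity :
    vder I (fun t => cross (g t) (D I g t))
           (fun t => vscale (- geod_curv t) (D I g t)).
  Proof.
    refine (vder_ext I _ _ _ _ _ _ (vder_cross I _ _ _ _
      (vsmooth_vder _ _ Hg) (vsmooth_vder _ _ (vsmooth_D _ _ Hg)))).
    - reflexivity.
    - intros t Ht. rewrite cross_self, vadd_0_l.
      apply cross_in_normal_plane; auto using velocity_orth_position, inner_acceleration_velocity.
  Qed.

  Lemma cross_cross_position_velocity (t : R) :
    I t -> cross (cross (g t) (D I g t)) (D I g t) = g t.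
  Proof.
    intros Ht. rewrite cross_cross_r, (Hu t Ht), (velocity_orth_position t Ht).
    generalize (g t), (D I g t). intros. vec_ring.
  Qed.

  Lemma inner_combination (a w t : R) : I t ->
    let V := vscale a (vadd (g t) (vscale w (cross (g t) (D I g t)))) in
    inner V V = a * a * (w * w - 1).
  Proof.
    intros Ht V. unfold V.
    rewrite inner_vscale_l, inner_vscale_r, !inner_vadd_l, !inner_vadd_r,
      !inner_vscale_l, !inner_vscale_r, inner_cross_cross,
      (inner_sym (cross _ _)), inner_cross_l, (Hh t Ht), (Hu t Ht), (velocity_orth_position t Ht).
    ring.
  Qed.

  Lemma smooth_geod_curv : smooth_on I geod_curv.
  Proof.
    apply smooth_inner; [exact HI | | apply vsmooth_cross];
      auto using vsmooth_D.
  Qed.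

  Variables (c : R -> vec) (a w : R).
  Hypothesis Hw : 0 < 1 - w * w.
  Hypothesis Hw0 : w <> 0.
  Hypothesis Ha : a <> 0.
  Let V (t : R) : vec :=
    vscale a (vadd (g t) (vscale w (cross (g t) (D I g t)))).
  Hypothesis Hc : vder I c V.

  Lemma vsmooth_combination : vsmooth I V.
  Proof.
    apply (vsmooth_vscale I (fun _ => a)); [exact HI | apply se_const |].
    apply vsmooth_vadd; [exact HI | exact Hg |].
    apply (vsmooth_vscale I (fun _ => w)); [exact HI | apply se_const |].
    apply vsmooth_cross; auto using vsmooth_D.
  Qed.

  (** All terms are parallel to the velocity of [g], whence the normal of the
      antiderivative is that velocity, up to sign. *)
  Lemma vder_combination :
    vder I V (fun t => vscale (a * (1 - w * geod_curv t)) (D I g t)).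
  Proof.
    refine (vder_ext I _ _ _ _ _ _ (vder_vscale I a _ _
      (vder_vadd I _ _ _ _ (vsmooth_vder _ _ Hg)
        (vder_vscale I w _ _ vder_cross_position_velocity)))).
    - reflexivity.
    - intros t _. generalize (D I g t), (geod_curv t). intros. vec_ring.
  Qed.

  Lemma vsmooth_antiderivative : vsmooth I c.
  Proof. exact (vsmooth_of_vder I c V HI Hc vsmooth_combination). Qed.

  Lemma antiderivative_time_like : time_like_curve I c.
  Proof.
    assert (Htl : forall t, I t -> time_like (D I c t)).
    { intros t Ht. unfold time_like. rewrite (D_eq I c V t HI Hc Ht).
      unfold V. rewrite inner_combination by exact Ht.
      assert (0 < a * a) by nra. nra. }
    split; [split |]; [split; [exact HI | exact vsmooth_antiderivative] | | exact Htl].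
    intros t Ht H0. specialize (Htl t Ht). unfold time_like in Htl.
    rewrite H0 in Htl. revert Htl. unfold inner, vzero; simpl. lra.
  Qed.

  Variable p : R.
  Hypothesis Hp : 0 < p.
  Hypothesis Hpa : p * p * (a * a) * (1 - w * w) = 1.
  Let J := rescale I 0 p.
  Let alpha (r : R) : vec := c (0 + p * r).

  Let HJ : interval J := interval_rescale I 0 p Hp HI.

  Lemma antiderivative_tangent (r : R) : J r -> D J alpha r = vscale p (V (0 + p * r)).
  Proof.
    intros Hr. exact (D_eq J _ _ r HJ (vder_rescale I 0 p _ _ Hc) Hr).
  Qed.

  (** The combination [V] has constant pseudo-norm [/ p], so arc length is an
      affine parameter. *)
  Lemma antiderivative_arc_length : arc_length_param I c J alpha.
  Proof.
    assert (Hip : p <> 0) by lra.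
    split; [| split].
    - split; [exact HJ |]. exact (vsmooth_rescale I 0 p c Hp HI vsmooth_antiderivative).
    - intros r Hr. rewrite (antiderivative_tangent r Hr). unfold norm.
      rewrite inner_vscale_l, inner_vscale_r. unfold V at 1 2.
      rewrite inner_combination by exact Hr.
      replace (p * (p * (a * a * (w * w - 1)))) with (-1) by lra.
      rewrite Rabs_left by lra. replace (- -1) with 1 by ring. apply sqrt_1.
    - exists (fun t => 0 + / p * t). split; [| split; [| split]].
      + refine (smooth_expr_smooth I _ _ HI (se_affine I 0 (/ p) HI) _). reflexivity.
      + intros t Ht.
        rewrite (deriv_eq I _ (fun _ => / p) t HI Ht (der_affine I 0 (/ p))).
        rewrite (D_eq I c V t HI Hc Ht). unfold norm, V.
        rewrite inner_combination by exact Ht.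
        symmetry. rewrite <- (sqrt_Rsqr (/ p)) by (left; apply Rinv_0_lt_compat, Hp).
        f_equal. rewrite Rabs_left by (assert (0 < a * a) by nra; nra).
        unfold Rsqr. apply (Rmult_eq_reg_l (p * p)); [| nra].
        transitivity 1; [lra | field; exact Hip].
      + intros r. split.
        * intros Hr. exists (0 + p * r). split; [exact Hr | field; exact Hip].
        * intros [t [Ht ->]]. unfold J, rescale.
          replace (0 + p * (0 + / p * t)) with t by (field; exact Hip). exact Ht.
      + intros t _. unfold alpha. f_equal. field. exact Hip.
  Qed.

  (** The curvature of [alpha] with a sign, the component of its acceleration
      along the velocity of [g]. *)
  Let mu (r : R) : R := p * p * (a * (1 - w * geod_curv (0 + p * r))).

  Lemma antiderivative_acceleration (r : R) : J r ->
    D J (D J alpha) r = vscale (mu r) (D I g (0 + p * r)).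
  Proof.
    intros Hr.
    apply (D_eq J (D J alpha) (fun r => vscale (mu r) (D I g (0 + p * r))));
      [exact HJ | | exact Hr].
    refine (vder_ext J _ _ _ _ _ _ (vder_vscale J p _ _ (vder_rescale I 0 p _ _ vder_combination))).
    - intros t Ht. symmetry. exact (antiderivative_tangent t Ht).
    - intros t _. unfold mu. rewrite !vscale_vscale. f_equal; ring.
  Qed.

  Lemma antiderivative_curvature (r : R) : J r -> curvature J alpha r = Rabs (mu r).
  Proof.
    intros Hr. change (norm (D J (D J alpha) r) = Rabs (mu r)).
    rewrite (antiderivative_acceleration r Hr). apply norm_vscale_unit, Hu, Hr.
  Qed.

  Hypothesis Hk : forall r, J r -> curvature J alpha r <> 0.

  (** The sign cannot change without a zero of the curvature, by continuity. Its
      constancy is what lets it be absorbed in a Bertrand constant. *)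
  Lemma signed_curvature_sign :
    exists eta, eta * eta = 1 /\ forall r, J r -> Rabs (mu r) = eta * mu r.
  Proof.
    apply sign_const; [exact HJ | | ].
    - assert (Hs : smooth_expr J mu).
      { unfold mu. apply se_mult; [apply se_const |].
        apply se_mult; [apply se_const |].
        apply (se_plus J (fun _ => 1)
          (fun r => - (w * geod_curv (0 + p * r)))); [apply se_const |].
        assert (Hs : smooth_on J (fun r => - (w * geod_curv (0 + p * r)))).
        { refine (smooth_expr_smooth J _ _ HJ (se_mult J _ _ (se_const J (- w))
            (se_rescale I 0 p _ Hp HI (se_smooth I _ smooth_geod_curv))) _).
          intros t _. simpl. ring. }
        apply se_smooth, Hs. }
      destruct (smooth_expr_der J mu Hs) as [mu' [_ Hd]].
      exact (der_cont J mu mu' Hd).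
    - intros r Hr H0. apply (Hk r Hr). rewrite (antiderivative_curvature r Hr), H0. apply Rabs_R0.
  Qed.

  (** With [k] the geodesic curvature of [g], the curvature is
      [eta * p^2 * a * (1 - w * k)] and the torsion is [p^2 * a * (k - w)], where
      [eta] is the sign above. Both are affine in [k], and [eta * a], [a * w]
      are the coefficients for which [k] cancels. *)
  Lemma antiderivative_bertrand : time_like_bertrand I c.
  Proof.
    destruct signed_curvature_sign as [eta [Heta Hmu]].
    assert (Heta0 : eta <> 0) by nra.
    assert (HN : forall r, J r -> normal J alpha r = vscale eta (D I g (0 + p * r))).
    { intros r Hr. unfold normal.
      pose proof (Hk r Hr) as Hkr.
      change (curvature J alpha r) with (norm (D J (D J alpha) r)) in Hkr.
      pose proof (antiderivative_curvature r Hr) as Hc'.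
      change (curvature J alpha r) with (norm (D J (D J alpha) r)) in Hc'.
      rewrite Hc', (Hmu r Hr) in *. rewrite (antiderivative_acceleration r Hr), vscale_vscale.
      f_equal. assert (mu r <> 0) by (intros H; apply Hkr; rewrite H; ring).
      apply (Rmult_eq_reg_l eta); [| exact Heta0]. rewrite Heta. field. auto. }
    exists (eta * a), (a * w).
    split; [exact antiderivative_time_like |].
    exists J, alpha. split; [exact antiderivative_arc_length |]. split; [exact Hk |].
    split; [apply Rmult_integral_contrapositive_currified; assumption |].
    split; [apply Rmult_integral_contrapositive_currified; assumption |].
    intros r Hr. rewrite (antiderivative_curvature r Hr), (Hmu r Hr).
    unfold torsion, binormal, tangent.
    rewrite (D_eq J (normal J alpha)
      (fun r => vscale eta (vscale p (D I (D I g) (0 + p * r)))) r HJ); [| | exact Hr].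
    2:{ refine (vder_ext J _ _ _ _ _ _ (vder_vscale J eta _ _
          (vder_rescale I 0 p _ _ (vsmooth_vder _ _ (vsmooth_D _ _ Hg))))).
        - intros s Hs. symmetry. exact (HN s Hs).
        - reflexivity. }
    rewrite (HN r Hr), (antiderivative_tangent r Hr). unfold V, mu.
    assert (Ht : I (0 + p * r)) by exact Hr. set (t := 0 + p * r) in *.
    repeat rewrite ?cross_vscale_l, ?cross_vscale_r, ?cross_vadd_l.
    rewrite (cross_cross_position_velocity t Ht).
    repeat rewrite ?inner_vscale_l, ?inner_vscale_r, ?inner_vadd_r.
    rewrite (inner_acceleration_position t Ht). fold (geod_curv t).
    generalize (geod_curv t). intros k.
    transitivity (eta * eta * (p * p * (a * a) * (1 - w * w))); [ring |].
    rewrite Heta, Hpa. ring.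
  Qed.
End HyperbolicCurve.

(** * Bertrand curves come from unit speed curves in the hyperbolic plane *)

Section TimeLikeFrame.
  Variables (J : R -> Prop) (alpha : R -> vec).
  Hypothesis HJ : interval J.
  Hypothesis Ha : vsmooth J alpha.
  Hypothesis HT : forall s, J s -> inner (D J alpha s) (D J alpha s) = -1.
  Hypothesis Hk : forall s, J s -> curvature J alpha s <> 0.
  Let T := tangent J alpha.
  Let N := normal J alpha.
  Let B := binormal J alpha.
  Let kappa := curvature J alpha.
  Let tau := torsion J alpha.

  Let ST : vsmooth J T := vsmooth_D J alpha Ha.

  Lemma frame_T_T' (s : R) : J s -> inner (T s) (D J T s) = 0.
  Proof. apply (inner_self_const_der J T _ (-1)); auto using vsmooth_vder. Qed.

  Lemma frame_T'_T' (s : R) :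
    J s -> inner (D J T s) (D J T s) = kappa s * kappa s.
  Proof.
    intros Hs. unfold kappa, curvature. fold T. rewrite norm_sq, Rabs_right; [reflexivity |].
    apply Rle_ge, (inner_pos_of_orth_time_like (T s)); [| exact (frame_T_T' s Hs)].
    unfold time_like. unfold T, tangent. rewrite (HT s Hs). lra.
  Qed.

  Let normal_E (s : R) : N s = vscale (/ kappa s) (D J T s) := eq_refl.

  Lemma frame_T' (s : R) : J s -> D J T s = vscale (kappa s) (N s).
  Proof.
    intros Hs. rewrite normal_E, vscale_vscale.
    replace (kappa s * / kappa s) with 1 by (field; apply (Hk s Hs)).
    symmetry; apply vscale_1.
  Qed.

  Lemma frame_N_N (s : R) : J s -> inner (N s) (N s) = 1.
  Proof.
    intros Hs. rewrite normal_E, inner_vscale_l, inner_vscale_r, (frame_T'_T' s Hs). field. apply (Hk s Hs).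
  Qed.

  Lemma frame_T_N (s : R) : J s -> inner (T s) (N s) = 0.
  Proof.
    intros Hs. rewrite normal_E, inner_vscale_r, (frame_T_T' s Hs). ring.
  Qed.

  (** The normalizing factor is smooth because the acceleration is space-like,
      so that the absolute value in the pseudo-norm can be dropped. *)
  Lemma frame_smooth_N : vsmooth J N.
  Proof.
    assert (Hpos : forall s, J s -> 0 < inner (D J T s) (D J T s)).
    { intros s Hs. rewrite (frame_T'_T' s Hs). pose proof (Hk s Hs).
      unfold kappa. nra. }
    apply (vsmooth_ext J (fun s => vscale (/ sqrt (inner (D J T s) (D J T s))) (D J T s)));
      [exact HJ | |].
    - intros s Hs. rewrite normal_E. do 2 f_equal.
      change (kappa s) with (norm (D J T s)). unfold norm. rewrite Rabs_right; [reflexivity |].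
      left. exact (Hpos s Hs).
    - apply vsmooth_vscale; [exact HJ | | exact (vsmooth_D J T ST)].
      apply se_inv.
      + intros s Hs. pose proof (sqrt_lt_R0 _ (Hpos s Hs)). lra.
      + apply se_sqrt; [exact Hpos |].
        apply se_smooth, smooth_inner; auto using vsmooth_D.
  Qed.

  Lemma frame_vder_T : vder J T (fun s => vscale (kappa s) (N s)).
  Proof.
    exact (vder_ext J _ _ _ _ (fun s _ => eq_refl) frame_T' (vsmooth_vder J T ST)).
  Qed.

  (** The derivative of [N] is orthogonal to [N], hence [cross_in_normal_plane]
      applies to its product with [T]. *)
  Lemma frame_vder_B : vder J B (fun s => vscale (- tau s) (N s)).
  Proof.
    refine (vder_ext J _ _ _ _ _ _ (vder_cross J _ _ _ _ frame_vder_T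
      (vsmooth_vder J N frame_smooth_N))).
    - reflexivity.
    - intros s Hs. rewrite cross_vscale_l, cross_self.
      rewrite (cross_in_normal_plane (T s) (N s));
        auto using frame_N_N, frame_T_N.
      + change (inner (D J N s) (cross (T s) (N s))) with (tau s).
        generalize (N s), (tau s). intros. vec_ring.
      + rewrite inner_sym.
        apply (inner_self_const_der J N _ 1);
          auto using vsmooth_vder, frame_smooth_N, frame_N_N.
  Qed.

  Lemma frame_B_N (s : R) : J s -> cross (B s) (N s) = T s.
  Proof.
    intros Hs. change (B s) with (cross (T s) (N s)).
    rewrite cross_cross_r, (frame_N_N s Hs), (frame_T_N s Hs).
    generalize (T s), (N s). intros. vec_ring.
  Qed.

  Lemma frame_B_B (s : R) : J s -> inner (B s) (B s) = 1.
  Proof.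
    intros Hs. change (B s) with (cross (T s) (N s)).
    rewrite inner_cross_cross, (frame_N_N s Hs), (frame_T_N s Hs).
    change (inner (T s) (T s)) with (inner (D J alpha s) (D J alpha s)).
    rewrite (HT s Hs). ring.
  Qed.

  Variables a w p s0 : R.
  Hypothesis Ha0 : a <> 0.
  Hypothesis Hp : 0 < p.
  Hypothesis Hpa : p * p = a * a * (1 - w * w).
  Hypothesis Hlin : forall s, J s -> a * kappa s + a * w * tau s = 1.
  Hypothesis Hs0 : J s0.
  Let I := rescale J s0 p.
  Let W (s : R) : vec := vscale (a / p) (vadd (T s) (vscale (- w) (B s))).
  (** Solving [T = cosh xi * g + sinh xi * h] and [B = cosh xi * h + sinh xi * g]
      for [g], where [tanh xi = w], gives a multiple of [T - w * B]; the factor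
      [a / p] makes its pseudo-norm [1]. *)
  Definition indicatrix (r : R) : vec :=
    vscale (a / p) (vadd (tangent J alpha (s0 + p * r))
                         (vscale (- w) (binormal J alpha (s0 + p * r)))).
  Let g := indicatrix.

  Let HI : interval I := interval_rescale J s0 p Hp HJ.

  Lemma indicatrix_0 : I 0.
  Proof. unfold I, rescale. replace (s0 + p * 0) with s0 by ring. exact Hs0. Qed.

  (** This is where the Bertrand relation enters: the coefficient of [N] is
      [a / p * (kappa + w * tau)]. *)
  Lemma vder_frame_combination : vder J W (fun s => vscale (/ p) (N s)).
  Proof.
    refine (vder_ext J _ _ _ _ _ _ (vder_vscale J (a / p) _ _
      (vder_vadd J _ _ _ _ frame_vder_T (vder_vscale J (- w) _ _ frame_vder_B)))).
    - reflexivity.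
    - intros s Hs. rewrite <- (Rmult_1_r (/ p)), <- (Hlin s Hs).
      generalize (N s), (kappa s), (tau s). intros. unfold Rdiv. vec_ring.
  Qed.

  Lemma indicatrix_vder : vder I g (fun r => N (s0 + p * r)).
  Proof.
    refine (vder_ext I _ _ _ _ _ _ (vder_rescale J s0 p _ _ vder_frame_combination)).
    - reflexivity.
    - intros r _. rewrite vscale_vscale.
      replace (p * / p) with 1 by (field; lra). apply vscale_1.
  Qed.

  Lemma indicatrix_D (r : R) : I r -> D I g r = N (s0 + p * r).
  Proof. exact (D_eq I g _ r HI indicatrix_vder). Qed.

  Lemma indicatrix_smooth : vsmooth I g.
  Proof.
    apply (vsmooth_of_vder I g _ HI indicatrix_vder).
    exact (vsmooth_rescale J s0 p N Hp HJ frame_smooth_N).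
  Qed.

  Lemma indicatrix_speed (r : R) : I r -> inner (D I g r) (D I g r) = 1.
  Proof. intros Hr. rewrite (indicatrix_D r Hr). apply frame_N_N, Hr. Qed.

  Lemma indicatrix_unit_speed : unit_speed I g.
  Proof.
    intros r Hr. rewrite <- (vscale_1 (D I g r)).
    rewrite norm_vscale_unit by exact (indicatrix_speed r Hr). apply Rabs_R1.
  Qed.

  Lemma indicatrix_space_like : space_like_curve I g.
  Proof.
    split; [split |].
    - split; [exact HI | exact indicatrix_smooth].
    - intros r Hr H0. pose proof (indicatrix_speed r Hr) as H. rewrite H0 in H.
      revert H. unfold inner, vzero; simpl. lra.
    - intros r Hr. left. rewrite (indicatrix_speed r Hr). lra.
  Qed.

  Lemma indicatrix_hyperbolic (r : R) : I r -> in_hyperbolic_space (g r).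
  Proof.
    intros Hr. unfold in_hyperbolic_space, g, indicatrix. set (s := s0 + p * r).
    fold T B. assert (Hs : J s) by exact Hr.
    repeat rewrite ?inner_vscale_l, ?inner_vscale_r, ?inner_vadd_l, ?inner_vadd_r.
    rewrite (frame_B_B s Hs), (inner_sym (B s)).
    change (inner (T s) (T s)) with (inner (D J alpha s) (D J alpha s)).
    rewrite (HT s Hs). change (B s) with (cross (T s) (N s)). rewrite inner_cross_l.
    transitivity (- (a * a * (1 - w * w)) / (p * p)); [field; lra |].
    rewrite <- Hpa. field. lra.
  Qed.

  (** The coefficients of [B] cancel, and what is left of [T] is the velocity of
      the rescaled curve. *)
  Lemma indicatrix_velocity (r : R) : I r ->
    vscale a (vadd (g r) (vscale w (cross (g r) (D I g r)))) =
    vscale p (T (s0 + p * r)).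
  Proof.
    intros Hr. rewrite (indicatrix_D r Hr). unfold g, indicatrix.
    set (s := s0 + p * r). fold T B. assert (Hs : J s) by exact Hr.
    rewrite cross_vscale_l, cross_vadd_l, cross_vscale_l, (frame_B_N s Hs).
    change (cross (T s) (N s)) with (B s).
    transitivity (vscale (a * a * (1 - w * w) / p) (T s)).
    - generalize (T s), (B s). intros. unfold Rdiv. vec_ring.
    - f_equal. rewrite <- Hpa. field. lra.
  Qed.

  Lemma indicatrix_integral (xi r : R) : tanh xi = w -> I r ->
    alpha (s0 + p * r) = vadd (alpha s0) (gamma_tilde I g a xi r).
  Proof.
    intros Hxi Hr.
    pose proof (vder_gamma_tilde I g a xi HI indicatrix_0 indicatrix_smooth) as Hg.
    rewrite Hxi in Hg.
    pose proof (vder_ext I _ _ _ _ (fun t _ => eq_refl) indicatrix_velocity Hg) as Hg'.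
    pose proof (eq_of_vder_eq I _ _ _ 0 r HI
      (vder_rescale J s0 p alpha T (vsmooth_vder J alpha Ha)) Hg' indicatrix_0 Hr
      (gamma_tilde_0 I g a xi)) as H.
    rewrite H. do 2 f_equal. ring.
  Qed.
End TimeLikeFrame.

(** * The correspondence *)

Theorem lemma2 :
  (forall (I : R -> Prop) (g : R -> vec) (a theta u : R),
     I 0 ->
     space_like_curve I g ->
     unit_speed I g ->
     (forall t, I t -> in_hyperbolic_space (g t)) ->
     a <> 0 -> theta <> 0 -> 0 < u -> u <> 1 ->
     curvature_nowhere_zero I (gamma_tilde I g a (xi2 theta u)) ->
     time_like_bertrand I (gamma_tilde I g a (xi2 theta u)))
  /\
  (forall (J : R -> Prop) (beta : R -> vec) (A B : R),
     time_like_bertrand_with A B J beta ->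
     Rabs B < Rabs A ->
     exists (I : R -> Prop) (g : R -> vec) (a theta u : R),
       I 0 /\
       space_like_curve I g /\
       unit_speed I g /\
       (forall t, I t -> in_hyperbolic_space (g t)) /\
       a <> 0 /\ theta <> 0 /\ 0 < u /\ u <> 1 /\
       exists (p : vec) (v : R -> R),
         smooth_on J v /\
         (forall t, J t -> 0 < deriv J v t) /\
         (forall r, I r <-> exists t, J t /\ r = v t) /\
         (forall t, J t ->
            beta t = vadd p (gamma_tilde I g a (xi2 theta u) (v t)))).
Proof.
  split.
  - intros I g a theta u H0 [[[HI Hg] _] Hsl] Hus Hhyp Ha Htheta Hu Hu1 Hk.
    set (xi := xi2 theta u) in *.
    pose proof (tanh_sq_lt_1 xi) as Hw.
    pose proof (tanh_neq_0 xi (xi2_neq_0 theta u Htheta Hu Hu1)) as Hw0.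
    assert (Hspeed : forall t, I t -> inner (D I g t) (D I g t) = 1).
    { intros t Ht. apply space_like_unit; auto. }
    assert (Hpos : 0 < a * a * (1 - tanh xi * tanh xi)).
    { apply Rmult_lt_0_compat; [nra | exact Hw]. }
    (* [q] is the constant speed of the curve. *)
    set (q := sqrt (a * a * (1 - tanh xi * tanh xi))).
    assert (Hq : 0 < q) by (apply sqrt_lt_R0, Hpos).
    assert (Hqq : q * q = a * a * (1 - tanh xi * tanh xi)) by (apply sqrt_sqrt; lra).
    pose proof (Rinv_0_lt_compat q Hq) as Hp.
    assert (Hpa : / q * / q * (a * a) * (1 - tanh xi * tanh xi) = 1).
    { rewrite Rmult_assoc, <- Hqq. field. lra. }
    pose proof (vder_gamma_tilde I g a xi HI H0 Hg) as Hc.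
    apply (antiderivative_bertrand I g HI Hg Hhyp Hspeed _ a (tanh xi) Hw Hw0 Ha Hc
             (/ q) Hp Hpa).
    apply Hk. exact (antiderivative_arc_length I g HI Hg Hhyp Hspeed _ a (tanh xi) Hw Ha Hc
             (/ q) Hp Hpa).
  - intros J0 beta A B [[[[HJ0 Hbeta] _] Htl] [J [alpha [Harc [Hk [HA [HB Hlin]]]]]]] HAB.
    destruct Harc as [[HJ Halpha] [Hus [s [Hs [Hs' [HJs Hbs]]]]]].
    assert (HT : forall r, J r -> inner (D J alpha r) (D J alpha r) = -1).
    { intros r Hr. apply time_like_unit; [| apply Hus, Hr].
      destruct (proj1 (HJs r) Hr) as [t [Ht ->]].
      specialize (Htl t Ht). unfold time_like in *.
      (* By the chain rule the velocity of [alpha] is a multiple of that of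
         [beta], hence has the same causal character. *)
      rewrite (D_eq J0 beta (fun t => vscale (deriv J0 s t) (D J alpha (s t))) t) in Htl;
        [| exact HJ0 | | exact Ht].
      - rewrite inner_vscale_l, inner_vscale_r in Htl.
        set (x := inner _ _) in *. clearbody x. set (d := deriv J0 s t) in *.
        clearbody d. pose proof (Rle_0_sqr d) as Hd. unfold Rsqr in Hd.
        apply Rnot_le_lt. intros Hx. nra.
      - refine (vder_ext J0 _ _ _ _ _ (fun _ _ => eq_refl) (vder_comp J0 J s _ alpha _ _ (Hs O)
          (vsmooth_vder J alpha Halpha))).
        + intros r Hr'. symmetry. exact (Hbs r Hr').
        + intros r Hr'. apply HJs. exists r. auto. }
    set (w := B / A).
    assert (Hw : 0 < 1 - w * w).
    { assert (HBA : B * B < A * A) by (apply Rsqr_lt_abs_1; exact HAB).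
      assert (0 < A * A) by nra.
      replace (1 - w * w) with ((A * A - B * B) * / (A * A)) by (unfold w; field; exact HA).
      apply Rmult_lt_0_compat; [lra | apply Rinv_0_lt_compat; lra]. }
    destruct (tanh_surj w Hw) as [xi Hxi].
    assert (Hxi0 : xi <> 0).
    { intros ->. apply HB. unfold tanh in Hxi. rewrite sinh_0 in Hxi.
      replace B with (w * A) by (unfold w; field; exact HA).
      rewrite <- Hxi. unfold Rdiv. ring. }
    destruct (xi2_surj xi Hxi0) as [theta [u [Htheta [Hu [Hu1 Hxi2]]]]].
    assert (Hpos : 0 < A * A * (1 - w * w)) by (apply Rmult_lt_0_compat; [nra | exact Hw]).
    set (p := sqrt (A * A * (1 - w * w))).
    assert (Hp : 0 < p) by (apply sqrt_lt_R0, Hpos).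
    assert (Hpa : p * p = A * A * (1 - w * w)) by (apply sqrt_sqrt; lra).
    assert (Hlin' : forall r, J r -> A * curvature J alpha r + A * w * torsion J alpha r = 1).
    { intros r Hr. replace (A * w) with B by (unfold w; field; exact HA). auto. }
    destruct HJ0 as [HJ0c [t0 [t1 [Ht0 Ht1]]]].
    assert (Hs0 : J (s t0)) by (apply HJs; exists t0; auto).
    pose proof (conj HJ0c (ex_intro _ t0 (ex_intro _ t1 (conj Ht0 Ht1))) : interval J0) as HJ0.
    exists (rescale J (s t0) p), (indicatrix J alpha A w p (s t0)), A, theta, u.
    split; [exact (indicatrix_0 J p (s t0) Hs0) |].
    split; [apply (indicatrix_space_like J alpha HJ Halpha HT Hk A w p (s t0)); assumption |].
    split; [apply (indicatrix_unit_speed J alpha HJ Halpha HT Hk A w p (s t0)); assumption |].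
    split; [apply (indicatrix_hyperbolic J alpha HJ Halpha HT Hk A w p (s t0)); assumption |].
    do 4 (split; [assumption |]).
    (* The base point [s t0] of the integral is moved to [0], and [r] is the
       parameter for which arc length is [s t0 + p * r]. *)
    exists (alpha (s t0)), (fun t => / p * s t + - s t0 / p).
    assert (Hv : der J0 (fun t => / p * s t + - s t0 / p) (fun t => / p * deriv J0 s t)).
    { refine (der_ext J0 _ _ _ _ _ _ (der_plus J0 _ _ _ _
        (der_mult J0 _ _ _ _ (der_const J0 (/ p)) (Hs O)) (der_const J0 (- s t0 / p))));
        intros t _; simpl; ring. }
    assert (Hsv : forall t, s t0 + p * (/ p * s t + - s t0 / p) = s t)
      by (intros t; field; lra).
    split; [| split; [| split]].
    + exact (smooth_expr_smooth J0 _ _ HJ0 (se_plus J0 _ _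
        (se_mult J0 _ _ (se_const J0 (/ p)) (se_smooth J0 _ Hs))
        (se_const J0 (- s t0 / p))) (fun t _ => eq_refl)).
    + intros t Ht. rewrite (deriv_eq J0 _ _ t HJ0 Ht Hv), (Hs' t Ht).
      apply Rmult_lt_0_compat; [apply Rinv_0_lt_compat, Hp |].
      apply sqrt_lt_R0, Rabs_pos_lt. specialize (Htl t Ht). unfold time_like in Htl. lra.
    + intros r. split.
      * intros Hr. destruct (proj1 (HJs _) Hr) as [t [Ht Hrt]].
        exists t. split; [exact Ht |]. rewrite <- Hrt. field. lra.
      * intros [t [Ht ->]]. unfold rescale. rewrite Hsv. apply HJs. exists t. auto.
    + intros t Ht. rewrite (Hbs t Ht), <- (Hsv t) at 1. rewrite Hxi2.
      apply (indicatrix_integral J alpha HJ Halpha HT Hk A w p (s t0)); try assumption.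
      unfold rescale. rewrite Hsv. apply HJs. exists t. auto.
Qed.
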